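(* Let $S$ be a solution concept (for games with a fixed player set $\{1,\dots,n\}$, $n\ge 2$) that permits bracketing and satisfies distribution-monotonicity, anonymity, scale-invariance, and interiority. Then there exists $\lambda=(\lambda_1,\lambda_2,\lambda_3)\in\mathbb{R}_{\ge0}^3$ such that $S$ is a refinement of $\text{Min-Max-Mean}_\lambda$, i.e., for every game $G$, every $p\in S(G)$ is a $\text{Min-Max-Mean}_\lambda$ equilibrium of $G$.
   Context: Games. Fix an integer $n\ge 2$ and the player set $\{1,\dots,n\}$. All actions belong to a fixed nonempty universal set $\mathcal{A}$ that is closed under pairing, $\mathcal{A}\times\mathcal{A}\subseteq\mathcal{A}$ (hence infinite). A game $G=(A,u)$ consists of $A=\prod_i A_i$ with each $A_i\subset\mathcal{A}$ finite and nonempty, and $u\colon A\to\mathbb{R}^n$. A mixed strategy profile is $p=(p_1,\dots,p_n)\in\prod_i\Delta A_i$; it is identified with the product distribution on $A$, and $p_{-i}$ is its marginal on $A_{-i}=\prod_{j\ne i}A_j$. For $a_i\in A_i$, $u_i(a_i,p_{-i})$ denotes the lottery (distribution of payoffs) of player $i$ when playing $a_i$ while the others play $p_{-i}$, and $\mathbb{E}[u_i(a_i,p_{-i})]$ its expectation. Solution concepts. A solution concept $S$ assigns to each game $G=(A,u)$ a nonempty set $S(G)\subseteq\prod_i\Delta A_i$. Bracketing. For $G=(A,u)$, $H=(B,v)$ the composite game $G\otimes H=(C,w)$ has $C_i=A_i\times B_i$ and $w_i((a_1,b_1),\dots,(a_n,b_n))=u_i(a)+v_i(b)$. For profiles $p,q$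 of $G,H$, $[p\times q]_i(a_i,b_i)=p_i(a_i)q_i(b_i)$. $S$ permits bracketing if for all games $G,H$: $p\in S(G)$ and $q\in S(H)$ imply $p\times q\in S(G\otimes H)$. Stochastic dominance. $X\ge_{\mathrm{FOSD}}Y$ means $\Pr[X>t]\ge\Pr[Y>t]$ for all $t\in\mathbb{R}$; $X>_{\mathrm{FOSD}}Y$ means in addition that the distributions differ. Distribution-monotonicity: for every game $G=(A,u)$, $p\in S(G)$, player $i$, $a_i,b_i\in A_i$: $u_i(a_i,p_{-i})>_{\mathrm{FOSD}}u_i(b_i,p_{-i})$ implies $p_i(a_i)\ge p_i(b_i)$. Anonymity. For a permutation $\pi$ of $\{1,\dots,n\}$ and $G=(A,u)$, the permuted game $G_\pi=(B,v)$ has $B_i=A_{\pi(i)}$ and $v_i(a_{\pi(1)},\dots,a_{\pi(n)})=u_{\pi(i)}(a_1,\dots,a_n)$; the permuted profile is $(p_\pi)_i=p_{\pi(i)}$. $S$ satisfies anonymity if $p\in S(G)$ implies $p_\pi\in S(G_\pi)$ for all $G$, $\pi$. Scale-invariance. Whenever $p_i$ is the uniform distribution on $A_i$ for all $i$, $p\in S(A,u)$ implies $p\in S(A,\alpha\cdot u)$ for all $\alpha\in(0,1)$. Interiority. For every game $G=(A,u)$, $p\in S(G)$, player $i$ and $a_i\in A_i$: $p_i(a_i)>0$. Min-Max-Mean. Given $\lambda\in\mathbb{R}_{\ge0}^3$, a profile $p$ is a $\text{Min-Max-Mean}_\lambda$ equilibrium of $G=(A,u)$ if for all players $i$ and $a_i\in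 A_i$, $p_i(a_i)\propto\exp\big(\lambda_1\min_{a_{-i}\in A_{-i}}u_i(a_i,a_{-i})+\lambda_2\mathbb{E}[u_i(a_i,p_{-i})]+\lambda_3\max_{a_{-i}\in A_{-i}}u_i(a_i,a_{-i})\big)$ (equality up to normalization over $a_i\in A_i$). *)

(* Defs.v *)
From HB Require Import structures.
From mathcomp Require Import all_boot all_order all_algebra all_fingroup.
From mathcomp Require Import finmap.
From mathcomp Require Import all_classical all_reals all_analysis.

Set Implicit Arguments.
Unset Strict Implicit.
Unset Printing Implicit Defensive.

Import Order.TTheory GRing.Theory Num.Theory.
Local Open Scope fset_scope.
Local Open Scope classical_set_scope.
Local Open Scope ring_scope.

(* U is the universal set of actions; the pairing of actions is an injection
   U * U -> U, passed explicitly to the notions that depend on it. A nonempty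
   set containing its set-theoretic pairs is infinite; for an abstract
   injection this has to be assumed, to exclude a one-element U. *)
Section Games.
Context (R : realType) (U : choiceType) (n : nat).

Record game := Game {
  actions : 'I_n -> {fset U};
  actions_neq0 : forall i, actions i != fset0;
  payoff : 'I_n -> {dffun forall i : 'I_n, actions i} -> R
}.

Definition profile (G : game) := {dffun forall i : 'I_n, actions G i}.

Definition strategies (G : game) := forall i : 'I_n, {ffun actions G i -> R}.

Definition simplex (T : finType) : set {ffun T -> R} :=
  [set p : {ffun T -> R} | (forall x, 0 <= p x) /\ \sum_x p x = 1].

Definition mixed (G : game) : set (strategies G) :=
  [set p : strategies G | forall i, simplex (p i)].

(* The opponents' profiles a_{-i} are represented by the full profiles a whose
   i-th coordinate is the given action ai; the weight of a under p_{-i} then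
   leaves out the i-th factor. *)
Definition opp_weight (G : game) (p : strategies G) (i : 'I_n)
    (a : profile G) : R :=
  \prod_(j | j != i) p j (a j).

(* The law of u_i(ai, p_{-i}), as a function of events E. *)
Definition lottery (G : game) (p : strategies G) (i : 'I_n) (ai : actions G i)
    (E : pred R) : R :=
  \sum_(a : profile G | (a i == ai) && E (payoff i a)) opp_weight p i a.

Definition mean_payoff (G : game) (p : strategies G) (i : 'I_n)
    (ai : actions G i) : R :=
  \sum_(a : profile G | a i == ai) opp_weight p i a * payoff i a.

Lemma actions_inhabited (G : game) (i : 'I_n) : exists x : actions G i, true.
Proof. by case/fset0Pn: (actions_neq0 G i) => x xA; exists [` xA]. Qed.

Definition profile_with (G : game) (i : 'I_n) (ai : actions G i) : profile G :=
  finfun (dfwith (fun j => xchoose (actions_inhabited G j)) i ai).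

(* The base point profile_with ai plays ai itself, so it is one of the
   profiles the minimum (maximum) ranges over. *)
Definition min_payoff (G : game) (i : 'I_n) (ai : actions G i) : R :=
  \big[Num.min/payoff i (profile_with ai)]_(a : profile G | a i == ai)
    payoff i a.

Definition max_payoff (G : game) (i : 'I_n) (ai : actions G i) : R :=
  \big[Num.max/payoff i (profile_with ai)]_(a : profile G | a i == ai)
    payoff i a.

Definition fosd (X Y : pred R -> R) : Prop :=
  forall t : R, Y (fun x => t < x) <= X (fun x => t < x).

Definition strict_fosd (X Y : pred R -> R) : Prop := fosd X Y /\ X <> Y.

Definition prod_act (pr : U * U -> U) (A B : {fset U}) : {fset U} :=
  [fset pr ab | ab in (A `*` B)%fset].

Lemma prod_act_neq0 (pr : U * U -> U) (A B : {fset U}) :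
  A != fset0 -> B != fset0 -> prod_act pr A B != fset0.
Proof.
move=> /fset0Pn[a aA] /fset0Pn[b bB]; apply/fset0Pn; exists (pr (a, b)).
by apply/imfsetP; exists (a, b) => //=; rewrite in_fsetM aA bB.
Qed.

Lemma prod_actP (pr : U * U -> U) (A B : {fset U}) (c : prod_act pr A B) :
  exists ab : A * B, pr (fsval ab.1, fsval ab.2) == fsval c.
Proof.
case/imfsetP: (fsvalP c) => -[a b] /=; rewrite in_fsetM => /andP[aA bB] cE.
by exists ([` aA], [` bB]); rewrite /= cE.
Qed.

(* The components of a composite action, unique when pr is injective. *)
Definition unpair (pr : U * U -> U) (A B : {fset U}) (c : prod_act pr A B) :
  A * B := xchoose (prod_actP c).

Definition composite (pr : U * U -> U) (G H : game) : game :=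
  @Game (fun i => prod_act pr (actions G i) (actions H i))
    (fun i => prod_act_neq0 pr (actions_neq0 G i) (actions_neq0 H i))
    (fun i c => payoff i [ffun j => (unpair (c j)).1]
              + payoff i [ffun j => (unpair (c j)).2]).

Definition prod_strategies (pr : U * U -> U) (G H : game)
    (p : strategies G) (q : strategies H) : strategies (composite pr G H) :=
  fun i => [ffun c => p i (unpair c).1 * q i (unpair c).2].

Lemma unpermute_subproof (A : 'I_n -> {fset U}) (s : 'S_n)
    (b : forall i, A (s i)) (j : 'I_n) : fsval (b (s^-1%g j)) \in A j.
Proof.
by have := fsvalP (b (s^-1%g j)); move: (fsval _) => x; rewrite permKV.
Qed.

(* The profile a such that b i = a (s i) for all i. *)
Definition unpermute (A : 'I_n -> {fset U}) (s : 'S_n)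
    (b : {dffun forall i, A (s i)}) : {dffun forall i, A i} :=
  [ffun j => [` unpermute_subproof b j]].

Definition permuted (s : 'S_n) (G : game) : game :=
  @Game (fun i => actions G (s i)) (fun i => actions_neq0 G (s i))
    (fun i b => payoff (s i) (unpermute b)).

Definition permuted_strategies (s : 'S_n) (G : game) (p : strategies G) :
  strategies (permuted s G) := fun i => p (s i).

Definition scaled (alpha : R) (G : game) : game :=
  @Game (actions G) (actions_neq0 G) (fun i a => alpha * payoff i a).

Definition correspondence := forall G : game, set (strategies G).

Definition solution_concept (S : correspondence) : Prop :=
  forall G, S G !=set0 /\ S G `<=` @mixed G.

Definition permits_bracketing (pr : U * U -> U) (S : correspondence) : Prop :=
  forall (G H : game) (p : strategies G) (q : strategies H),
    S G p -> S H q -> S (composite pr G H) (prod_strategies pr p q).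

Definition distribution_monotone (S : correspondence) : Prop :=
  forall (G : game) (p : strategies G) (i : 'I_n) (ai bi : actions G i),
    S G p -> strict_fosd (lottery p ai) (lottery p bi) -> p i bi <= p i ai.

Definition anonymous (S : correspondence) : Prop :=
  forall (s : 'S_n) (G : game) (p : strategies G),
    S G p -> S (permuted s G) (permuted_strategies s p).

Definition uniform_profile (G : game) (p : strategies G) : Prop :=
  forall (i : 'I_n) (ai : actions G i), p i ai = (#|` actions G i|%:R)^-1.

Definition scale_invariant (S : correspondence) : Prop :=
  forall (G : game) (p : strategies G), uniform_profile p -> S G p ->
    forall alpha : R, 0 < alpha < 1 -> S (scaled alpha G) p.

Definition interior_valued (S : correspondence) : Prop :=
  forall (G : game) (p : strategies G) (i : 'I_n) (ai : actions G i),
    S G p -> 0 < p i ai.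

Definition mmm_index (l1 l2 l3 : R) (G : game) (p : strategies G) (i : 'I_n)
    (ai : actions G i) : R :=
  l1 * min_payoff ai + l2 * mean_payoff p ai + l3 * max_payoff ai.

Definition min_max_mean (l1 l2 l3 : R) (G : game) : set (strategies G) :=
  [set p : strategies G | forall (i : 'I_n) (ai : actions G i),
     p i ai = expR (mmm_index l1 l2 l3 p ai)
              / \sum_(bi : actions G i) expR (mmm_index l1 l2 l3 p bi)].

Definition refines (S T : correspondence) : Prop := forall G, S G `<=` T G.

End Games.

(* Main.v *)
(** Extend the log-odds ln p_i(a) - ln p_i(b) to a relation between the lotteries
    of a and b. Bracketing makes it additive under independent sums, and since k
    copies of a weak dominance plus the constant 1 are a strict dominance,
    distribution-monotonicity makes it monotone; so it depends on the lotteries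
    only, and anonymity makes it the same for all players. On constants it is
    linear. A player facing an indifferent, hence uniform, opponent chooses
    between a Bernoulli lottery and a constant of equal value; the profile is then
    uniform, and scale-invariance makes the values of Bernoulli lotteries
    homogeneous. Finally k copies of an arbitrary lottery with minimum x0, mean mu
    and maximum x1 are squeezed, for k large, between sums of a constant close to
    k mu, a Bernoulli lottery reaching k x1 and a negative Bernoulli lottery
    reaching k x0, whose values divided by k have as limits the same combination
    of x0, mu and x1. *)
Require Import Defs.
From mathcomp Require Import all_boot all_order all_algebra all_fingroup.
From mathcomp Require Import finmap.
From mathcomp Require Import all_classical all_reals all_analysis.
From mathcomp Require Import ring lra.

Import Order.TTheory GRing.Theory Num.Theory.
Local Open Scope classical_set_scope.
Local Open Scope ring_scope.

Set Implicit Arguments.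
Unset Strict Implicit.
Unset Printing Implicit Defensive.

(** * Finite lotteries as weighted lists, and their calculus *)

Section Lotteries.
Context {R : realType}.
Implicit Types (X Y Z : seq (R * R)) (f g : R -> R).

(* A lottery is the list of its (weight, value) pairs. *)
Definition expect X f : R := \sum_(x <- X) x.1 * f x.2.

Definition is_lottery X : Prop :=
  (forall x, x \in X -> 0 <= x.1) /\ \sum_(x <- X) x.1 = 1.

(** Equality in distribution: lists that order or split their atoms differently have to count as one
    lottery. *)
Definition same X Y : Prop := forall f, expect X f = expect Y f.

(* First-order dominance, tested against all nondecreasing functions rather
   than upper intervals: this form is symmetric under [neg]. *)
Definition dom X Y : Prop :=
  forall f, {homo f : x y / x <= y} -> expect Y f <= expect X f.

Definition const (c : R) : seq (R * R) := [:: (1, c)].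

(** The weight is the one that an opponent mixing uniformly over [m.+1] actions puts on one of them;
    [m = 0] gives a constant. *)
Definition bern (m : nat) (s : R) : seq (R * R) :=
  [:: (m.+1%:R^-1, s); (1 - m.+1%:R^-1, 0)].

Definition conv X Y : seq (R * R) :=
  [seq (x.1 * y.1, x.2 + y.2) | x <- X, y <- Y].

Definition neg X : seq (R * R) := [seq (x.1, - x.2) | x <- X].

Definition scl (a : R) X : seq (R * R) := [seq (x.1, a * x.2) | x <- X].

Definition copies X (k : nat) : seq (R * R) := iter k (conv X) (const 0).

Definition mean X : R := expect X id.

Definition variance X : R := expect X (fun x => (x - mean X) ^+ 2).

Lemma expect_const c f : expect (const c) f = f c.
Proof. by rewrite /expect big_seq1 mul1r. Qed.

Lemma expect_bern m s f :
  expect (bern m s) f = m.+1%:R^-1 * f s + (1 - m.+1%:R^-1) * f 0.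
Proof. by rewrite /expect big_cons big_seq1. Qed.

Lemma expect_conv X Y f :
  expect (conv X Y) f = expect X (fun x => expect Y (fun y => f (x + y))).
Proof.
rewrite /expect big_allpairs_dep; apply: eq_bigr => x _; rewrite mulr_sumr.
by apply: eq_bigr => y _; rewrite mulrA.
Qed.

Lemma expect_neg X f : expect (neg X) f = expect X (fun x => f (- x)).
Proof. by rewrite /expect big_map. Qed.

Lemma expect_scl a X f : expect (scl a X) f = expect X (fun x => f (a * x)).
Proof. by rewrite /expect big_map. Qed.

Lemma expectD X f g : expect X (fun x => f x + g x) = expect X f + expect X g.
Proof. by rewrite /expect -big_split; apply: eq_bigr => x _; rewrite mulrDr. Qed.

Lemma expectZ X a f : expect X (fun x => a * f x) = a * expect X f.
Proof. by rewrite /expect mulr_sumr; apply: eq_bigr => x _; rewrite mulrCA. Qed.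

Lemma expectN X f : expect X (fun x => - f x) = - expect X f.
Proof. by rewrite /expect -sumrN; apply: eq_bigr => x _; rewrite mulrN. Qed.

Lemma eq_expect X f g : f =1 g -> expect X f = expect X g.
Proof. by move=> fg; apply: eq_bigr => x _; rewrite fg. Qed.

Lemma expect_cst X c : is_lottery X -> expect X (fun=> c) = c.
Proof. by case=> _ X1; rewrite /expect -mulr_suml X1 mul1r. Qed.

Lemma le_expect X f g : is_lottery X -> (forall x, x \in X -> f x.2 <= g x.2) ->
  expect X f <= expect X g.
Proof.
move=> [X0 _] fg; rewrite /expect big_seq [leRHS]big_seq; apply: ler_sum => x xX.
by rewrite ler_wpM2l ?X0 ?fg.
Qed.

Lemma same_sym X Y : same X Y -> same Y X.
Proof. by move=> h f; rewrite h. Qed.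

Lemma same_dom X Y : same X Y -> dom X Y.
Proof. by move=> h f _; rewrite h. Qed.

Lemma dom_trans X Y Z : dom X Y -> dom Y Z -> dom X Z.
Proof. by move=> h h' f fm; exact: le_trans (h' f fm) (h f fm). Qed.

Lemma convC X Y : same (conv X Y) (conv Y X).
Proof.
move=> f; rewrite !expect_conv /expect; under eq_bigr do rewrite mulr_sumr.
rewrite exchange_big; apply: eq_bigr => y _; rewrite mulr_sumr.
by apply: eq_bigr => x _; rewrite mulrCA addrC.
Qed.

Lemma same_conv X X' Y Y' : same X X' -> same Y Y' -> same (conv X Y) (conv X' Y').
Proof.
by move=> hX hY f; rewrite !expect_conv hX; apply: eq_expect => x; rewrite hY.
Qed.

Lemma conv0 X : same (conv X (const 0)) X.
Proof. by move=> f; rewrite expect_conv; apply: eq_expect => x; rewrite expect_const addr0. Qed.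

Lemma negK : involutive neg.
Proof. by move=> X; rewrite /neg -map_comp map_id_in // => -[w v] _ /=; rewrite opprK. Qed.

Lemma neg_conv X Y : same (neg (conv X Y)) (conv (neg X) (neg Y)).
Proof.
move=> f; rewrite expect_neg !expect_conv expect_neg; apply: eq_expect => x.
by rewrite expect_neg; apply: eq_expect => y; rewrite opprD.
Qed.

Lemma neg_const c : neg (const c) = const (- c).
Proof. by []. Qed.

Lemma neg_bern m s : neg (bern m s) = bern m (- s).
Proof. by rewrite /neg /bern /= oppr0. Qed.

Lemma bern0 s : same (bern 0 s) (const s).
Proof. by move=> f; rewrite expect_bern expect_const invr1 subrr mul0r addr0 mul1r. Qed.

Lemma lottery_const c : is_lottery (const c).
Proof. by split=> [x|]; rewrite ?inE ?big_seq1// => /eqP->; exact: ler01. Qed.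

Lemma lottery_bern m s : is_lottery (bern m s).
Proof.
have le1 : m.+1%:R^-1 <= 1 :> R by rewrite invf_le1 ?ler1n.
split=> [x|]; last by rewrite big_cons big_seq1 /= addrC subrK.
by rewrite !inE => /orP[] /eqP-> /=; rewrite ?invr_ge0 ?subr_ge0.
Qed.

Lemma lottery_conv X Y : is_lottery X -> is_lottery Y -> is_lottery (conv X Y).
Proof.
move=> lX lY; split=> [z /allpairsP[[x y] [/= xX yY ->]]/=|].
  by apply: mulr_ge0; [case: lX => + _; exact|case: lY => + _; exact].
have -> : \sum_(z <- conv X Y) z.1 = expect (conv X Y) (fun=> 1).
  by apply: eq_bigr => z _; rewrite mulr1.
by rewrite expect_conv -[RHS](expect_cst 1 lX); apply: eq_expect => x; rewrite expect_cst.
Qed.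

Lemma lottery_neg X : is_lottery X -> is_lottery (neg X).
Proof.
by case=> X0 X1; split=> [z /mapP[x xX ->]|]; [exact: (X0 _ xX)|rewrite big_map].
Qed.

Lemma lottery_copies X k : is_lottery X -> is_lottery (copies X k).
Proof.
by move=> lX; elim: k => [|k IH]; [exact: lottery_const|exact: lottery_conv].
Qed.

(** One summand is replaced at a time, through the intermediate [conv X Y']. *)
Lemma dom_conv X X' Y Y' : is_lottery X -> is_lottery Y' ->
  dom X X' -> dom Y Y' -> dom (conv X Y) (conv X' Y').
Proof.
move=> lX lY' hX hY f fm; rewrite !expect_conv.
apply: (@le_trans _ _ (expect X (fun x => expect Y' (fun y => f (x + y))))).
  apply: hX => x x' xx'; apply: le_expect => // y _; apply: fm; by rewrite lerD2r.
apply: le_expect => // x _; apply: hY => y y' yy'; apply: fm; by rewrite lerD2l.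
Qed.

Lemma dom_copies X Y k : is_lottery X -> is_lottery Y -> dom X Y ->
  dom (copies X k) (copies Y k).
Proof.
move=> lX lY h; elim: k => [|k IH]; first exact: same_dom.
by apply: dom_conv => //; exact: lottery_copies.
Qed.

Lemma dom_neg X Y : dom X Y -> dom (neg Y) (neg X).
Proof.
move=> h f fm; rewrite !expect_neg -lerN2 -!expectN; apply: h => x y xy.
by rewrite lerN2 fm // lerN2.
Qed.

Lemma neg_copies X k : same (neg (copies X k)) (copies (neg X) k).
Proof.
elim: k => [|k IH]; first by rewrite /copies /const /neg /= oppr0.
move=> f; rewrite neg_conv; exact: same_conv.
Qed.

Lemma mean_const c : mean (const c) = c.
Proof. exact: expect_const. Qed.

Lemma mean_conv X Y : is_lottery X -> is_lottery Y ->
  mean (conv X Y) = mean X + mean Y.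
Proof.
move=> lX lY; rewrite /mean expect_conv -[expect Y id](expect_cst _ lX) -expectD.
by apply: eq_expect => x; rewrite expectD expect_cst.
Qed.

Lemma mean_neg X : mean (neg X) = - mean X.
Proof. by rewrite /mean expect_neg expectN. Qed.

Lemma mean_copies X k : is_lottery X -> mean (copies X k) = k%:R * mean X.
Proof.
move=> lX; elim: k => [|k IH]; first by rewrite mean_const mul0r.
by rewrite mean_conv ?IH ?mulrS ?mulrDl ?mul1r //; exact: lottery_copies.
Qed.

Lemma variance_copies X k :
  is_lottery X -> variance (copies X k) = k%:R * variance X.
Proof.
move=> lX; rewrite /variance; elim: k => [|k IH].
  by rewrite /= expect_const mean_const subrr expr0n mul0r.
rewrite mean_copies // /= expect_conv.
have lk := lottery_copies k lX.
(* The deviation splits into that of the new summand and that of the previous copies; the cross term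
   has expectation zero. *)
under eq_expect => x.
  rewrite (@eq_expect _ _ (fun y => ((x - mean X) ^+ 2 +
    (2 * (x - mean X)) * (y + - mean (copies X k))) + (y - mean (copies X k)) ^+ 2)); last first.
    by move=> y; rewrite mean_copies // mulrS; ring.
  rewrite !expectD expectZ expectD !expect_cst // IH subrr mulr0 addr0; over.
by rewrite expectD expect_cst // mulrS mulrDl mul1r.
Qed.

(** The mean is a sum over finitely many values, each weighted by the probability of a singleton
    event. Hence different means certify that two lotteries differ on some event. *)
Lemma eq_mean X Y :
  (forall E : pred R, expect X (fun x => (E x)%:R) = expect Y (fun x => (E x)%:R)) ->
  mean X = mean Y.
Proof.
move=> h; pose V := undup ([seq x.2 | x <- X] ++ [seq y.2 | y <- Y]).
have key Z : {subset [seq z.2 | z <- Z] <= V} ->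
    mean Z = \sum_(v <- V) v * expect Z (fun x => (x == v)%:R).
  move=> sZ; under [RHS]eq_bigr do rewrite -expectZ.
  rewrite /mean /expect exchange_big /= big_seq [RHS]big_seq; apply: eq_bigr => z zZ.
  have zV : z.2 \in V by apply: sZ; exact: map_f.
  rewrite (bigD1_seq z.2) ?undup_uniq //= eqxx mulr1 big1 ?addr0 // => v.
  by rewrite eq_sym => /negPf->; rewrite mulr0 mulr0.
rewrite !key; first by apply: eq_bigr => v _; rewrite (h (pred1 v)).
  by move=> v vY; rewrite mem_undup mem_cat vY orbT.
by move=> v vX; rewrite mem_undup mem_cat vX.
Qed.

End Lotteries.

(** * Stochastic bounds on sums of many independent copies *)

Section LargeNumbers.
Context {R : realType}.
Implicit Types (X : seq (R * R)) (f : R -> R).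

(** Positive weight at both ends makes [x0] and [x1] the exact minimum and maximum, not mere
    bounds. *)
Definition spans X (x0 x1 : R) : Prop :=
  [/\ is_lottery X, forall x, x \in X -> x0 <= x.2 <= x1,
      exists2 p, 0 < p & (p, x0) \in X & exists2 p, 0 < p & (p, x1) \in X].

Lemma spans_neg X x0 x1 : spans X x0 x1 -> spans (neg X) (- x1) (- x0).
Proof.
move=> [lX X01 [p p0 pX] [q q0 qX]]; split; first exact: lottery_neg.
- by move=> _ /mapP[x xX ->] /=; rewrite !lerN2 andbC X01.
- by exists q => //; apply/mapP; exists (q, x1).
- by exists p => //; apply/mapP; exists (p, x0).
Qed.

Lemma spans_mean X x0 x1 : spans X x0 x1 -> x0 <= mean X <= x1.
Proof.
case=> lX X01 _ _; apply/andP; split;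
  [rewrite -(expect_cst x0 lX)|rewrite -(expect_cst x1 lX)];
  by apply: le_expect => // x /X01/andP[].
Qed.

Lemma dom_const_lb X a : is_lottery X -> (forall x, x \in X -> a <= x.2) ->
  dom X (const a).
Proof.
move=> lX Xa f fm; rewrite expect_const -(expect_cst (f a) lX).
by apply: le_expect => // x /Xa/fm.
Qed.

Lemma dom_const_ub X b : is_lottery X -> (forall x, x \in X -> x.2 <= b) ->
  dom (const b) X.
Proof.
move=> lX Xb f fm; rewrite expect_const -(expect_cst (f b) lX).
by apply: le_expect => // x /Xb/fm.
Qed.

Lemma expect_atom X p x f : is_lottery X -> (p, x) \in X ->
  (forall y, 0 <= f y) -> p * f x <= expect X f.
Proof.
move=> [X0 _] pX f0; rewrite /expect (big_rem _ pX) /= lerDl big_seq.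
by apply: sumr_ge0 => y /mem_rem yX; rewrite mulr_ge0 ?X0.
Qed.

(** By independence, all [k] copies take the value [x] together with probability at least
    [p ^+ k]. *)
Lemma copies_atom X p x k f : is_lottery X -> (p, x) \in X ->
  (forall y, 0 <= f y) -> p ^+ k * f (k%:R * x) <= expect (copies X k) f.
Proof.
move=> lX pX; elim: k f => [|k IH] f f0; first by rewrite expect_const mul0r mul1r.
have p0 : 0 <= p by case: lX => /(_ _ pX).
rewrite expect_conv; have lk := lottery_copies k lX.
apply: (@le_trans _ _ (p * expect (copies X k) (fun y => f (x + y)))).
  rewrite exprS -mulrA ler_wpM2l //; apply: le_trans (IH _ _) => //.
  by rewrite mulrS mulrDl mul1r.
apply: (expect_atom (f := fun z => expect (copies X k) (fun y => f (z + y)))) => // z.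
by rewrite -(expect_cst 0 lk); exact: le_expect.
Qed.

Lemma copies_supp X x0 x1 k : (forall x, x \in X -> x0 <= x.2 <= x1) ->
  forall z, z \in copies X k -> k%:R * x0 <= z.2 <= k%:R * x1.
Proof.
move=> X01; elim: k => [|k IH] z /=; first by rewrite inE !mul0r => /eqP->; rewrite lexx.
move=> /allpairsP[[x y] [/= /X01/andP[xl xu] /IH/andP[yl yu] ->]] /=.
by rewrite !mulrS !mulrDl !mul1r !lerD.
Qed.

Lemma exists_nat_gt (x : R) : exists k : nat, x < k%:R.
Proof.
by exists (Num.truncn x).+1; have [x0|/ltW x0] := lerP 0 x;
  [case/andP: (truncn_itv x0)|apply: le_lt_trans x0 _; rewrite ltr0n].
Qed.

Lemma exists_inv_nat_le (x : R) : 0 < x -> exists2 m : nat, (0 < m)%N & m.+1%:R^-1 <= x.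
Proof.
move=> x0; have [k hk] := exists_nat_gt x^-1; exists k.+1 => //.
rewrite invf_ple ?posrE ?ltr0n //; apply: ltW; apply: lt_trans hk _.
by rewrite ltr_nat; apply: leqW.
Qed.

(** A sure amount plus two independent jumps, all proportional to [k], so that homogeneity will let
    [k] be factored out of the value. *)
Definition bracket (k m m' : nat) (c s s' : R) : seq (R * R) :=
  conv (conv (const (k%:R * c)) (bern m (k%:R * s))) (bern m' (k%:R * s')).

(* The upper tail of [copies X k] is compared to a fixed probability 1/(m+1) and
   its lower tail to 1/(m'+1), with [m'] chosen after [k]; Chebyshev's
   inequality is then enough and no large-deviation estimate is needed. *)
Lemma upper_bracket X x0 x1 (d : R) (m : nat) : spans X x0 x1 -> 0 < d ->
  exists k0 : nat, forall k, (k0 < k)%N -> exists m',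
    dom (bracket k m m' (mean X + d) (x1 - mean X + d) (- (mean X + d - x0)))
        (copies X k).
Proof.
move=> sX d0; case: (sX) => lX X01 [p p0 pX] _; have /andP[ml mu] := spans_mean sX.
(* This threshold brings the Chebyshev bound [t] below half of [1/(m+1)]. *)
have [k0 hk0] := exists_nat_gt (variance X / d ^+ 2 * (2 * m.+1%:R)).
exists k0 => k k0k.
have kgt0 : 0 < k%:R :> R by rewrite ltr0n (leq_trans _ k0k).
(* The bound [p ^+ k] is at most the probability [P] that the sum attains its minimum [l]; [0 < m']
   makes [e'] at most one half. *)
have [m' m'0 hm'] := exists_inv_nat_le (exprn_gt0 k p0).
exists m' => f fm; have lk := lottery_copies k lX.
set c := k%:R * (mean X + d); set l := k%:R * x0.
set u := c + k%:R * (x1 - mean X + d).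
set t := variance X / (k%:R * d ^+ 2).
set e := (m.+1%:R^-1 : R); set e' := (m'.+1%:R^-1 : R).
have e0 : 0 < e by rewrite invr_gt0.
have e'0 : 0 < e' by rewrite invr_gt0.
have e1 : e <= 1 by rewrite invf_le1 ?ler1n.
have e'2 : e' <= 2^-1 by rewrite lef_pV2 ?posrE // ler_nat.
have t_le : t <= e / 2.
  have -> : t = variance X / d ^+ 2 * (2 * m.+1%:R) / k%:R * (e / 2).
    by rewrite /t /e; field; rewrite !gt_eqF.
  rewrite ler_piMl ?divr_ge0 // ?(ltW e0) // ler_pdivrMr // mul1r.
  by rewrite ltW // (lt_trans hk0) // ltr_nat.
have lc : l <= c by rewrite ler_pM2l //; lra.
have cu : c <= u by rewrite /u lerDl mulr_ge0 // ?ltW //; lra.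
have ku : k%:R * x1 <= u by rewrite /u /c -mulrDr ler_pM2l //; lra.
have flc : f l <= f c by exact: fm.
have fcu : f c <= f u by exact: fm.
pose P := expect (copies X k) (fun z => (z == l)%:R).
have eP : e' <= P.
  apply: le_trans hm' _; rewrite -[leLHS]mulr1.
  have := @copies_atom X p x0 k (fun z => (z == l)%:R) lX pX.
  by rewrite eqxx; apply => y; exact: ler0n.
(* Integrates a pointwise majorant of [f]: the level [f c], plus a nonnegative quadratic that
   exceeds [f u - f c] beyond [c], minus the drop to [f l] at the minimum. *)
have upper : expect (copies X k) f <= f c + (f u - f c) * t - (f c - f l) * P.
  have -> : f c + (f u - f c) * t - (f c - f l) * P = expect (copies X k) (fun z =>
      f c + ((f u - f c) / (k%:R * d) ^+ 2 * (z - mean (copies X k)) ^+ 2 +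
             (- (f c - f l)) * (z == l)%:R)).
    rewrite expectD expect_cst // expectD !expectZ -/(variance (copies X k)) variance_copies // -/P /t.
    by field; rewrite gt_eqF //= gt_eqF.
  apply: le_expect => // z /(copies_supp X01)/andP[zl zu]; rewrite mean_copies //.
  have A0 : 0 <= f u - f c by rewrite subr_ge0.
  have q0 : 0 <= (f u - f c) / (k%:R * d) ^+ 2 * (z.2 - k%:R * mean X) ^+ 2.
    by rewrite mulr_ge0 ?sqr_ge0 // divr_ge0 ?sqr_ge0.
  set q := _ / _ * _ in q0 *; case: (eqVneq z.2 l) => [->|_]; first by rewrite mulr1; lra.
  rewrite mulr0 addr0; have [zc|cz] := leP z.2 c.
    by apply: (le_trans (fm _ _ zc)); rewrite lerDl.
  apply: (le_trans (fm _ _ (le_trans zu ku))).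
  rewrite /q -lerBlDl -mulrA ler_peMr // ler_pdivlMl ?mulr1; last first.
    by rewrite exprn_gt0 // mulr_gt0.
  rewrite ler_pXn2r ?nnegrE //; last 2 first.
  - by rewrite mulr_ge0 // ltW.
  - by move: cz; rewrite /c mulrDr; have := mulr_gt0 kgt0 d0; lra.
  by move: cz; rewrite /c mulrDr; lra.
apply: (le_trans upper).
rewrite /bracket !expect_conv expect_const expect_bern !expect_bern -/c -/e -/e' !addr0 -/u.
have -> : c + k%:R * - (mean X + d - x0) = l by rewrite /c /l; ring.
(* If both jumps occur, the bracket is bounded below by [l] only, which is enough. *)
have fl : f l <= f (u + k%:R * - (mean X + d - x0)).
  by apply: fm; rewrite /l /u /c -!mulrDr ler_pM2l //; lra.
have step : e * (e' * f l) <= e * (e' * f (u + k%:R * - (mean X + d - x0))).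
  by rewrite !ler_pM2l.
have h1 : 0 <= (f c - f l) * (P - e') by rewrite mulr_ge0 ?subr_ge0.
have h2 : 0 <= (f u - f c) * (e * (1 - e') - t).
  rewrite mulr_ge0 ?subr_ge0 //; apply: (le_trans t_le); rewrite ler_pM2l //; lra.
rewrite mulrDr mulrDr.
apply: le_trans (lerD (lerD step (lexx _)) (lexx _)).
rewrite -subr_ge0; move: (addr_ge0 h1 h2); congr (0 <= _); ring.
Qed.

Lemma neg_bracket k m m' (c s s' : R) :
  same (neg (bracket k m m' c s s')) (bracket k m m' (- c) (- s) (- s')).
Proof.
move=> f; rewrite neg_conv neg_bern -mulrN; apply: same_conv => // g.
by rewrite neg_conv neg_bern neg_const -!mulrN.
Qed.

(** The mirror image of the upper bound: [neg] reverses dominance and exchanges the two ends of the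
    support. *)
Lemma lower_bracket X x0 x1 (d : R) (m : nat) : spans X x0 x1 -> 0 < d ->
  exists k0 : nat, forall k, (k0 < k)%N -> exists m',
    dom (copies X k)
      (bracket k m m' (mean X - d) (- (mean X - x0 + d)) (x1 - mean X + d)).
Proof.
move=> sX d0; have [k0 h] := upper_bracket m (spans_neg sX) d0.
exists k0 => k /h[m' hm']; exists m'.
have {}hm' := dom_neg hm'.
apply: dom_trans (dom_trans hm' _); apply: same_dom => f.
  by rewrite neg_copies negK.
rewrite neg_bracket mean_neg; congr (expect (bracket _ _ _ _ _ _) f); ring.
Qed.

End LargeNumbers.

(** * Lotteries faced by players in composite, permuted and scaled games *)

Section Laws.
Context {R : realType} {U : choiceType} {n : nat}.
Implicit Types G H : game R U n.

Definition law G (p : strategies G) (i : 'I_n) (ai : actions G i) : seq (R * R) :=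
  [seq (opp_weight p i a, payoff i a) | a <- enum [pred a : profile G | a i == ai]].

Lemma expect_law G (p : strategies G) i (ai : actions G i) f :
  expect (law p ai) f = \sum_(a : profile G | a i == ai) opp_weight p i a * f (payoff i a).
Proof. by rewrite /expect big_map big_enum. Qed.

Lemma lotteryE G (p : strategies G) i (ai : actions G i) (E : pred R) :
  Defs.lottery p ai E = expect (law p ai) (fun x => (E x)%:R).
Proof.
rewrite expect_law /Defs.lottery big_mkcondr; apply: eq_bigr => a _.
by case: (E _); rewrite ?mulr1 ?mulr0.
Qed.

Lemma mean_payoffE G (p : strategies G) i (ai : actions G i) :
  mean_payoff p ai = mean (law p ai).
Proof. by rewrite /mean expect_law. Qed.

(** Distributivity for dependent functions; it lets a product distribution be summed one player at a
    time. *)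
Lemma sum_dffun (I : finType) (T_ : I -> finType) (F : forall i, T_ i -> R) :
  \sum_(b : {dffun forall i : I, T_ i}) \prod_i F i (b i) = \prod_i \sum_x F i x.
Proof.
rewrite (reindex (@dffun_of_fprod I T_)); last exact/onW_bij/dffun_of_fprod_bij.
pose P i := [ffun x : T_ i => F i x].
transitivity (\sum_(t : fprod T_) \prod_(i in I) P i (t i)).
  by apply: eq_bigr => t _; apply: eq_bigr => i _; rewrite !ffunE.
rewrite big_fprod; transitivity (\prod_i \sum_(u in tagged_with T_ i) untag 0 (P i) u).
  by rewrite bigA_distr_big_dep.
apply: eq_bigr => i _; transitivity (\sum_x P i x);
  first by rewrite (@big_tag _ _ _ _ _ (fun i => P i : T_ i -> R)).
by apply: eq_bigr => x _; exact: ffunE.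
Qed.

Lemma sum_opp_weight G (p : strategies G) (i j : 'I_n) (ai : actions G i) (g : U -> R) :
  mixed p -> j != i ->
  \sum_(a : profile G | a i == ai) opp_weight p i a * g (fsval (a j)) =
  \sum_h p j h * g (fsval h).
Proof.
move=> mp ji.
(* The factor of [i] is the indicator of [ai], that of [j] carries [g], and the others sum to one.
   Comparing actions in [U] avoids transporting [ai] along [l = i]. *)
pose F l (x : actions G l) : R :=
  (if l == i then (fsval x == fsval ai)%:R else p l x) *
  (if l == j then g (fsval x) else 1).
transitivity (\sum_(a : profile G) \prod_l F l (a l)).
  rewrite big_mkcond; apply: eq_bigr => a _; rewrite big_split /= (bigD1 i) //= eqxx.
  rewrite val_eqE; case: ifP => _; last by rewrite !mul0r.
  rewrite mul1r; congr (_ * _); first by apply: eq_bigr => l /negPf->.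
  by rewrite (bigD1 j) //= eqxx big1 ?mulr1 // => l /negPf->.
rewrite (sum_dffun F) (bigD1 j) //= [X in _ * X]big1 ?mulr1.
  by apply: eq_bigr => h _; rewrite /F eqxx (negPf ji).
move=> l lj; rewrite /F (negPf lj); have [li|li] := eqVneq l i.
  subst l; rewrite (bigD1 ai) //= eqxx mulr1 big1 ?addr0 // => x xa.
  by rewrite val_eqE (negPf xa) mul0r.
by under eq_bigr do rewrite mulr1; case: (mp l).
Qed.

Lemma lottery_law G (p : strategies G) (i j : 'I_n) (ai : actions G i) :
  mixed p -> j != i -> is_lottery (law p ai).
Proof.
move=> mp ji; split.
  by move=> _ /mapP[a _ ->]; apply: prodr_ge0 => l _; case: (mp l).
have -> : \sum_(x <- law p ai) x.1 = expect (law p ai) (fun=> 1).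
  by apply: eq_bigr => x _; rewrite mulr1.
rewrite expect_law (@sum_opp_weight G p i j ai (fun=> 1)) //.
by under eq_bigr do rewrite mulr1; case: (mp j).
Qed.

Section Pairing.
Variables (pr : U * U -> U) (hpr : injective pr).

Lemma pair_act_subproof (A B : {fset U}) (a : A) (b : B) :
  pr (fsval a, fsval b) \in prod_act pr A B.
Proof.
by apply/imfsetP; exists (fsval a, fsval b) => //=; rewrite in_fsetM !fsvalP.
Qed.

Definition pair_act (A B : {fset U}) (a : A) (b : B) : prod_act pr A B :=
  [` pair_act_subproof a b]%fset.

Lemma unpairK (A B : {fset U}) (c : prod_act pr A B) :
  pair_act (unpair c).1 (unpair c).2 = c.
Proof. by apply: val_inj; apply/eqP; exact: (xchooseP (prod_actP c)). Qed.

Lemma pair_actK (A B : {fset U}) (a : A) (b : B) : unpair (pair_act a b) = (a, b).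
Proof.
have /eqP/hpr[/val_inj ea /val_inj eb] := xchooseP (prod_actP (pair_act a b)).
by rewrite [LHS]surjective_pairing /unpair ea eb.
Qed.

(** Profiles of the composite game are pairs of profiles, and the opponents' weights multiply: play
    in the two games is independent. *)
Lemma law_composite G H (p : strategies G) (q : strategies H) i
    (a : actions G i) (b : actions H i) :
  same (@law (composite pr G H) (prod_strategies pr p q) i (pair_act a b))
       (conv (law p a) (law q b)).
Proof.
move=> f; rewrite expect_conv !expect_law.
pose D := (profile G * profile H)%type.
pose h (ab : D) : profile (composite pr G H) := [ffun l => pair_act (ab.1 l) (ab.2 l)].
pose h' (c : profile (composite pr G H)) : D :=
  ([ffun l => (unpair (c l)).1], [ffun l => (unpair (c l)).2]).
have hK : cancel h h'.
  move=> [x y]; congr (_, _); apply/ffunP => l; by rewrite !ffunE pair_actK.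
have h'K : cancel h' h.
  by move=> c; apply/ffunP => l; rewrite !ffunE unpairK.
rewrite (reindex h) /=; last by exists h' => ? _; [exact: hK|exact: h'K].
under [RHS]eq_bigr do rewrite expect_law mulr_sumr.
rewrite pair_big; apply: eq_big => [[x y] /=|[x y] _ /=].
  rewrite ffunE; apply/eqP/andP => [e|[/eqP-> /eqP->] //].
  by have := pair_actK (x i) (y i); rewrite e pair_actK => -[-> ->].
have -> : [ffun l => (unpair (h (x, y) l)).1] = x.
  by apply/ffunP => l; rewrite !ffunE pair_actK.
have -> : [ffun l => (unpair (h (x, y) l)).2] = y.
  by apply/ffunP => l; rewrite !ffunE pair_actK.
rewrite mulrA; congr (_ * _); rewrite -big_split; apply: eq_bigr => l _ /=.
by rewrite /prod_strategies !ffunE pair_actK.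
Qed.

End Pairing.

Lemma unpermuteE (A : 'I_n -> {fset U}) (s : 'S_n)
    (b : {dffun forall i, A (s i)}) l : unpermute b (s l) = b l.
Proof. by apply: val_inj; rewrite ffunE /= permK. Qed.

Lemma law_permuted G (p : strategies G) (s : 'S_n) l (a : actions G (s l)) :
  same (@law (permuted s G) (permuted_strategies s p) l a) (law p a).
Proof.
move=> f; rewrite !expect_law.
pose h (b : profile (permuted s G)) : profile G := unpermute b.
pose h' (a : profile G) : profile (permuted s G) := [ffun l => a (s l)].
have hK : cancel h h' by move=> b; apply/ffunP => k; rewrite ffunE unpermuteE.
have h'K : cancel h' h.
  by move=> c; apply/ffunP => k; rewrite -(permKV s k) unpermuteE ffunE.
rewrite [RHS](reindex h); last by exists h' => ? _; [exact: hK|exact: h'K].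
apply: eq_big => [b|b _]; first by rewrite unpermuteE.
congr (_ * _); rewrite /opp_weight [RHS](reindex_inj (@perm_inj _ s)) /=.
apply: eq_big => [k|k _]; first by rewrite (inj_eq perm_inj).
by rewrite unpermuteE.
Qed.

Lemma law_scaled G (p : strategies G) (al : R) i (a : actions G i) :
  same (@law (scaled al G) p i a) (scl al (law p a)).
Proof. by move=> f; rewrite expect_scl !expect_law. Qed.

Lemma min_payoffP G i (ai : actions G i) :
  (forall a : profile G, a i = ai -> min_payoff ai <= payoff i a) /\
  exists2 a : profile G, a i = ai & payoff i a = min_payoff ai.
Proof.
have wi : profile_with ai i == ai by rewrite ffunE dfwithin.
split=> [a /eqP aE|]; first exact: bigmin_le_cond.
case: (@arg_minP _ _ _ _ (fun a : profile G => a i == ai) (payoff i) wi).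
move=> a /eqP aE amin; exists a => //; apply/eqP; rewrite eq_le bigmin_le_cond ?aE// andbT.
by apply: le_bigmin => [|c]; exact: amin.
Qed.

Lemma max_payoffP G i (ai : actions G i) :
  (forall a : profile G, a i = ai -> payoff i a <= max_payoff ai) /\
  exists2 a : profile G, a i = ai & payoff i a = max_payoff ai.
Proof.
have wi : profile_with ai i == ai by rewrite ffunE dfwithin.
split=> [a /eqP aE|]; first exact: le_bigmax_cond.
case: (@arg_maxP _ _ _ _ (fun a : profile G => a i == ai) (payoff i) wi).
move=> a /eqP aE amax; exists a => //; apply/eqP; rewrite eq_le le_bigmax_cond ?aE//=.
by apply: bigmax_le => [|c]; exact: amax.
Qed.

(** Full support gives every opposing profile positive weight, so the extreme payoffs are atoms of
    the lottery. *)
Lemma spans_law G (p : strategies G) (i j : 'I_n) (ai : actions G i) :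
  mixed p -> j != i -> (forall l (x : actions G l), 0 < p l x) ->
  spans (law p ai) (min_payoff ai) (max_payoff ai).
Proof.
move=> mp ji p0; have w0 a : 0 < opp_weight p i a by exact: prodr_gt0.
have [minl [amin Amin Emin]] := min_payoffP ai.
have [maxl [amax Amax Emax]] := max_payoffP ai.
split; first exact: lottery_law mp ji.
- move=> _ /mapP[a + ->]; rewrite mem_enum inE => /eqP aE /=.
  by rewrite minl ?maxl.
- exists (opp_weight p i amin) => //; apply/mapP; exists amin; last by rewrite Emin.
  by rewrite mem_enum inE Amin.
- exists (opp_weight p i amax) => //; apply/mapP; exists amax; last by rewrite Emax.
  by rewrite mem_enum inE Amax.
Qed.

End Laws.

(** * Log-odds between lotteries *)

Section LogOdds.
Context {R : realType} {n : nat} {U : choiceType} {pr : U * U -> U}.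
Context {S : correspondence R U n}.
Arguments S : clear implicits.
Hypotheses (hn : (2 <= n)%N) (hpr : injective pr).
Hypotheses (hS : solution_concept S) (hbr : permits_bracketing pr S).
Hypotheses (hdm : distribution_monotone S) (han : anonymous S).
Hypotheses (hsc : scale_invariant S) (hin : interior_valued S).

(** A relation, because a pair of lotteries may arise in several games; that [d] is unique is
    derived later, from dominance. *)
Definition log_odds (i : 'I_n) (X Y : seq (R * R)) (d : R) : Prop :=
  [/\ is_lottery X, is_lottery Y & exists (G : game R U n) (p : strategies G)
    (a b : actions G i),
    [/\ S G p, same (law p a) X, same (law p b) Y & d = ln (p i a) - ln (p i b)]].

Lemma other_player (i : 'I_n) : exists j : 'I_n, j != i.
Proof.
have h0 : (0 < n)%N by exact: leq_trans hn.
have [->|] := eqVneq i (Ordinal h0); first by exists (Ordinal hn).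
by rewrite eq_sym => h; exists (Ordinal h0).
Qed.

Lemma S_mixed (G : game R U n) (p : strategies G) : S G p -> mixed p.
Proof. by move=> Gp; exact: (hS G).2. Qed.

Lemma log_odds_law (G : game R U n) (p : strategies G) i (a b : actions G i) :
  S G p -> log_odds i (law p a) (law p b) (ln (p i a) - ln (p i b)).
Proof.
move=> Gp; have [j ji] := other_player i; have mp := S_mixed Gp.
by split; [exact: lottery_law mp ji|exact: lottery_law mp ji|exists G, p, a, b].
Qed.

Lemma log_odds_same i X X' Y Y' d : is_lottery X' -> is_lottery Y' ->
  same X X' -> same Y Y' -> log_odds i X Y d -> log_odds i X' Y' d.
Proof.
move=> lX' lY' hX hY [_ _ [G [p [a [b [Gp hA hB dE]]]]]]; split=> //.
by exists G, p, a, b; split=> // f; rewrite ?hA ?hB.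
Qed.

Lemma log_odds_sym i X Y d : log_odds i X Y d -> log_odds i Y X (- d).
Proof.
move=> [lX lY [G [p [a [b [Gp hA hB ->]]]]]]; split=> //.
by exists G, p, b, a; rewrite opprB.
Qed.

(** In the product profile the choice probabilities multiply, and paired actions face independent
    sums. *)
Lemma log_odds_conv i X Y d X' Y' d' : log_odds i X Y d -> log_odds i X' Y' d' ->
  log_odds i (conv X X') (conv Y Y') (d + d').
Proof.
move=> [lX lY [G [p [a [b [Gp hA hB ->]]]]]] [lX' lY' [H [q [a' [b' [Hq hA' hB' ->]]]]]].
split; [exact: lottery_conv|exact: lottery_conv|].
exists (composite pr G H), (prod_strategies pr p q), (pair_act pr a a'), (pair_act pr b b').
split; first exact: hbr.
- by move=> f; rewrite law_composite //; exact: same_conv.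
- by move=> f; rewrite law_composite //; exact: same_conv.
rewrite /prod_strategies !ffunE !pair_actK //=.
by rewrite !lnM ?posrE ?hin //; ring.
Qed.

Lemma log_odds_player i i' X Y d : log_odds i X Y d -> log_odds i' X Y d.
Proof.
have [s ->] : exists s : 'S_n, i = s i' by exists (tperm i' i); rewrite tpermL.
move=> [lX lY [G [p [a [b [Gp hA hB ->]]]]]]; split=> //.
exists (permuted s G), (permuted_strategies s p), a, b; split=> //; first exact: han.
- by move=> f; rewrite law_permuted.
- by move=> f; rewrite law_permuted.
Qed.

(** The different means supply the strictness that distribution-monotonicity requires. *)
Lemma log_odds_mean i X Y d :
  log_odds i X Y d -> dom X Y -> mean X != mean Y -> 0 <= d.
Proof.
move=> [lX lY [G [p [a [b [Gp hA hB ->]]]]]] hXY /eqP mXY.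
rewrite subr_ge0 ler_ln ?posrE ?hin //; apply: (hdm Gp); split.
  move=> t; rewrite !lotteryE hA hB; apply: hXY => x y xy.
  by rewrite ler_nat; case: ltP => // tx; rewrite (lt_le_trans tx xy).
move=> e; apply: mXY; apply: eq_mean => E.
by rewrite -hA -hB -!lotteryE e.
Qed.

(** * A game offering a Bernoulli lottery against a constant *)

Section TestGame.
Context (e : nat -> U) (e_inj : injective e) (i j : 'I_n) (ji : j != i).
Context (m : nat) (s c : R).

Definition test_actions (l : 'I_n) : {fset U} :=
  if l == i then [fset e 0%N; e 1%N]%fset
  else if l == j then seq_fset tt (map e (iota 0 m.+1)) else [fset e 0%N]%fset.

Lemma test_actions0 l : e 0%N \in test_actions l.
Proof.
rewrite /test_actions; case: ifP => _; first by rewrite !inE eqxx.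
by case: ifP => _; rewrite ?seq_fsetE !inE eqxx.
Qed.

Lemma test_actions1 : e 1%N \in test_actions i.
Proof. by rewrite /test_actions eqxx !inE eqxx orbT. Qed.

Lemma test_actions_neq0 l : test_actions l != fset0.
Proof. by apply/fset0Pn; exists (e 0%N); exact: test_actions0. Qed.

(* Player [j] is indifferent and will therefore mix uniformly. *)
Definition test_game : game R U n :=
  @Game R U n test_actions test_actions_neq0 (fun l a =>
    if l == i then
      if fsval (a i) == e 1%N then (if fsval (a j) == e 0%N then s else 0) else c
    else 0).

Definition act0 : actions test_game i := [` test_actions0 i]%fset.
Definition act1 : actions test_game i := [` test_actions1]%fset.

Lemma law_cst (G : game R U n) (p : strategies G) l (x : actions G l) (b : R) :
  S G p -> (forall a : profile G, a l = x -> payoff l a = b) ->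
  same (law p x) (const b).
Proof.
move=> /S_mixed mp xb f; have [k kl] := other_player l.
rewrite expect_const -(expect_cst (f b) (lottery_law x mp kl)) !expect_law.
by apply: eq_bigr => a /eqP/xb ->.
Qed.

Lemma law_act0 (p : strategies test_game) : S test_game p ->
  same (law p act0) (const c).
Proof.
move=> Gp; apply: law_cst => // a /= ->; rewrite eqxx.
by rewrite [_ == e 1%N](inj_eq e_inj).
Qed.

Lemma law_idle (p : strategies test_game) l (x : actions test_game l) :
  S test_game p -> l != i -> same (law p x) (const 0).
Proof. by move=> Gp /negPf li; apply: law_cst => // a _ /=; rewrite li. Qed.

Lemma expect_law_act1 (p : strategies test_game) f : S test_game p ->
  expect (law p act1) f = \sum_h p j h * f (if fsval h == e 0%N then s else 0).
Proof.
move=> Gp; rewrite expect_law.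
rewrite -(@sum_opp_weight _ _ _ test_game p i j act1
  (fun u => f (if u == e 0%N then s else 0)) (S_mixed Gp) ji).
by apply: eq_bigr => a /eqP /= ->; rewrite !eqxx.
Qed.

Lemma test_act_i (x : actions test_game i) : x = act0 \/ x = act1.
Proof.
have := fsvalP x; rewrite /= {2}/test_actions eqxx !inE.
by case/orP => /eqP h; [left|right]; apply: val_inj.
Qed.

End TestGame.

Context {e : nat -> U} (e_inj : injective e).

(** With [m = 0] player [j] has the single action [e 0], so the risky action pays [s] for sure;
    nonemptiness of [S] provides the profile. *)
Lemma log_odds_const i (s c : R) : exists d, log_odds i (const s) (const c) d.
Proof.
have [j ji] := other_player i.
have [p Gp] := (hS (test_game e i j 0 s c)).1.
exists (ln (p i (act1 e i j 0 s c)) - ln (p i (act0 e i j 0 s c))).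
apply: log_odds_same (log_odds_law _ _ Gp); try exact: lottery_const.
  move=> f; rewrite expect_law_act1 // expect_const.
  have fs (h : actions (test_game e i j 0 s c) j) : fsval h == e 0%N.
    by have := fsvalP h; rewrite /= {2}/test_actions (negPf ji) eqxx seq_fsetE inE.
  under eq_bigr do rewrite fs.
  by rewrite -mulr_suml (S_mixed Gp j).2 mul1r.
exact: law_act0.
Qed.

Lemma log_odds_copies i X Y d k : log_odds i X Y d ->
  log_odds i (copies X k) (copies Y k) (k%:R * d).
Proof.
move=> h; elim: k => [|k IH]; last by rewrite mulrS mulrDl mul1r; exact: log_odds_conv.
(* For zero copies, some log-odds of [const 0] against itself is added to its opposite. *)
have [d0 h0] := log_odds_const i 0 0.
have := log_odds_conv h0 (log_odds_sym h0); rewrite subrr mul0r.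
by apply: log_odds_same; try exact: lottery_const; exact: conv0.
Qed.

(* Strict dominance is manufactured by adding the constant 1 to [k] independent
   copies: [k * d] is then bounded below for all [k]. *)
Lemma log_odds_dom i X Y d : log_odds i X Y d -> dom X Y -> 0 <= d.
Proof.
move=> h XY; have [d1 h1] := log_odds_const i 1 0.
have [lX lY _] := h.
have key k : 0 <= k%:R * d + d1.
  apply: (log_odds_mean (log_odds_conv (log_odds_copies k h) h1)).
    apply: dom_conv; [exact: lottery_copies|exact: lottery_const|exact: dom_copies|].
    by move=> f fm; rewrite !expect_const fm.
  have [lk lk'] := (lottery_copies k lX, lottery_copies k lY).
  rewrite !mean_conv ?mean_const ?addr0 //; try exact: lottery_const.
  have := dom_copies k lX lY XY (fun x y xy => xy : id x <= id y).
  rewrite -/(mean _) -/(mean _) => le; apply/eqP => eq; move: le; rewrite -eq; lra.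
rewrite leNgt; apply/negP => d0; have [k hk] := exists_nat_gt (d1 / - d).
move: hk; rewrite ltr_pdivrMr ?oppr_gt0 // => hk.
by have := key k; move: hk; rewrite mulrN; lra.
Qed.

(** The difference [d - d'] is a log-odds of [conv X Y'] against [conv Y X'], where the first
    dominates the second. *)
Lemma log_odds_le i X Y d X' Y' d' : log_odds i X Y d -> log_odds i X' Y' d' ->
  dom X X' -> dom Y' Y -> d' <= d.
Proof.
move=> h h' hX hY; have := log_odds_conv h (log_odds_sym h').
have [[lX lY _] [lX' lY' _]] := (h, h').
move=> /log_odds_dom H; rewrite -subr_ge0; apply: H.
apply: (@dom_trans _ _ (conv X' Y)); first exact: dom_conv.
exact/same_dom/convC.
Qed.

Lemma log_odds_inj i X d X' d' Y : log_odds i X Y d -> log_odds i X' Y d' ->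
  same X X' -> d = d'.
Proof.
move=> h h' XX'; apply/eqP; rewrite eq_le; apply/andP; split.
  by apply: (log_odds_le h' h) => //; exact/same_dom/same_sym.
by apply: (log_odds_le h h') => //; exact/same_dom.
Qed.

Lemma equal_weights (A : {fset U}) (p : {ffun A -> R}) :
  \sum_x p x = 1 -> (forall x y, p x = p y) -> forall x, p x = (#|` A|%:R)^-1.
Proof.
move=> p1 pE x; have : #|` A|%:R * p x = 1.
  rewrite -[RHS]p1 (eq_bigr (fun=> p x)) => [|y _]; last exact: pE.
  by rewrite sumr_const cardfE mulr_natl.
by move=> h; apply: (mulfI (x := #|` A|%:R)); rewrite ?h ?divff //;
  apply/eqP => h0; move: h; rewrite h0 mul0r => /eqP; rewrite eq_sym oner_eq0.
Qed.

(** Equal lotteries dominate each other weakly, so neither action is more likely. *)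
Lemma same_law_eq (G : game R U n) (p : strategies G) l (x y : actions G l) :
  S G p -> same (law p x) (law p y) -> p l x = p l y.
Proof.
move=> Gp xy; apply: ln_inj; rewrite ?posrE ?hin //.
apply/eqP; rewrite eq_le -[X in X && _]subr_ge0 -[X in _ && X]subr_ge0.
by rewrite !(log_odds_dom (log_odds_law _ _ Gp)) //; apply: same_dom => //;
  exact: same_sym.
Qed.

(** The other players are indifferent, hence uniform. If [d = 0], player [i] is uniform too, and
    scale-invariance, used only here, keeps the same profile in the scaled game. *)
Lemma log_odds_bern i m (s c : R) : exists2 d, log_odds i (bern m s) (const c) d &
  d = 0 -> forall al, 0 < al < 1 ->
    log_odds i (bern m (al * s)) (const (al * c)) 0.
Proof.
have [j ji] := other_player i.
pose G := test_game e i j m s c.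
pose a0 : actions G i := act0 e i j m s c.
pose a1 : actions G i := act1 e i j m s c.
have [p Gp] := (hS G).1; have mp := S_mixed Gp.
have unif l : l != i -> forall x, p l x = (#|` actions G l|%:R)^-1.
  move=> li; apply: equal_weights; first by case: (mp l).
  move=> x y; apply: same_law_eq => // f.
  by rewrite (law_idle x Gp li) (law_idle y Gp li).
have cardj : #|` actions G j| = m.+1.
  rewrite /= /test_actions (negPf ji) eqxx size_seq_fset undup_id ?size_map ?size_iota //.
  by rewrite map_inj_uniq // iota_uniq.
have law1 : same (law p a1) (bern m s).
  move=> f; rewrite expect_law_act1 // expect_bern.
  pose h0 : actions G j := [` test_actions0 e i j m j]%fset.
  rewrite (bigD1 h0) //= eqxx unif // cardj; congr (_ + _).
  have := (mp j).2; rewrite (bigD1 h0) //= unif // cardj => /(canRL (addKr _)) e1.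
  rewrite [1 - _]addrC -e1 mulr_suml.
  by apply: eq_bigr => h; rewrite -val_eqE /= => /negPf->.
have law0 : same (law p a0) (const c) by exact: law_act0.
exists (ln (p i a1) - ln (p i a0)).
  apply: log_odds_same (log_odds_law _ _ Gp) => //; [exact: lottery_bern|exact: lottery_const].
move=> /eqP; rewrite subr_eq0 => /eqP e10 al al01.
have {}e10 : p i a1 = p i a0 by apply: ln_inj e10; rewrite posrE hin.
have up : uniform_profile p.
  move=> l; have [->|li] := eqVneq l i; last exact: unif.
  apply: equal_weights; first by case: (mp i).
  by move=> x y; case: (test_act_i x) (test_act_i y) => [] -> [] ->.
have Sal := hsc up Gp al01; have := log_odds_law (G := scaled al G) a1 a0 Sal.
rewrite e10 subrr; apply: log_odds_same; [exact: lottery_bern|exact: lottery_const| |].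
  by move=> f; rewrite law_scaled expect_scl law1 !expect_bern mulr0.
by move=> f; rewrite law_scaled expect_scl law0 !expect_const.
Qed.

Lemma log_odds_eq0 i X Y d : log_odds i X Y d -> same X Y -> d = 0.
Proof.
move=> h XY; apply/eqP; rewrite eq_le -[d <= 0]oppr_ge0.
rewrite (log_odds_dom h) ?(log_odds_dom (log_odds_sym h)) //; apply: same_dom => //.
Qed.

(** In the combination [d + d' - d''] both sides are the independent sum of [X], [Y] and [Z], so it
    vanishes. *)
Lemma log_odds_trans i X Y Z d d' d'' : log_odds i X Y d -> log_odds i Y Z d' ->
  log_odds i X Z d'' -> d'' = d + d'.
Proof.
move=> h h' h''; apply/esym/eqP; rewrite -subr_eq0; apply/eqP.
apply: (log_odds_eq0 (log_odds_conv (log_odds_conv h h') (log_odds_sym h''))) => f.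
rewrite [RHS]convC !expect_conv; apply: eq_expect => x; rewrite expect_conv.
by apply: eq_expect => y; apply: eq_expect => z; rewrite addrA.
Qed.

(** * Values of lotteries against the constant zero, and their representation *)

Section Values.
Context (i : 'I_n) (h : nat -> R -> R).
Hypothesis hP : forall m s, log_odds i (bern m s) (const 0) (h m s).

(** Since [bern 0 s] is the constant [s], this is the value of a sure unit. *)
Let lam := h 0%N 1.

Lemma value_const c : log_odds i (const c) (const 0) (h 0%N c).
Proof.
by apply: log_odds_same (hP 0%N c) => //; [exact: lottery_const..|exact: bern0].
Qed.

Lemma log_odds_conv0 X Y d d' :
  log_odds i X (const 0) d -> log_odds i Y (const 0) d' ->
  log_odds i (conv X Y) (const 0) (d + d').
Proof.
move=> hX hY; have := log_odds_conv hX hY.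
apply: log_odds_same => //; last exact: conv0.
  by case: hX hY => lX _ _ [lY _ _]; exact: lottery_conv.
exact: lottery_const.
Qed.

Lemma value_const_add a b : h 0%N (a + b) = h 0%N a + h 0%N b.
Proof.
apply: log_odds_inj (value_const _) (log_odds_conv0 (value_const a) (value_const b)) _.
by move=> f; rewrite expect_conv !expect_const.
Qed.

Lemma value_le m m' a b : dom (bern m a) (bern m' b) -> h m' b <= h m a.
Proof. by move=> ab; apply: log_odds_le (hP m a) (hP m' b) _ _. Qed.

Lemma value_const_le a b : a <= b -> h 0%N a <= h 0%N b.
Proof. by move=> ab; apply: value_le => f fm; rewrite !bern0 !expect_const fm. Qed.

Lemma value_const_zero : h 0%N 0 = 0.
Proof. exact: log_odds_eq0 (value_const 0) _. Qed.

Lemma value_const_nat k a : h 0%N (k%:R * a) = k%:R * h 0%N a.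
Proof.
elim: k => [|k IH]; last by rewrite !mulrS !mulrDl !mul1r value_const_add IH.
by rewrite !mul0r value_const_zero.
Qed.

Lemma lam_ge0 : 0 <= lam.
Proof. by have := value_const_le ler01; rewrite value_const_zero. Qed.

(** A monotone additive function on the reals is linear. *)
Lemma value_const_linear c : h 0%N c = lam * c.
Proof.
wlog c0 : c / 0 <= c.
  move=> H; have [|/ltW c0] := leP 0 c; first exact: H.
  have := value_const_add c (- c); rewrite subrr value_const_zero (H (- c)) ?oppr_ge0 //; lra.
(* Both [h 0%N (k%:R * c)] and [lam * (k%:R * c)] lie between [lam] times the integer part of
   [k%:R * c] and [lam] more, so the error stays bounded in [k]. *)
have key k : `|k%:R * (h 0%N c - lam * c)| <= lam.
  have /andP[tl tu] := truncn_itv (mulr_ge0 (ler0n R k) c0).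
  have nat1 t : h 0%N t%:R = t%:R * lam by rewrite -[X in h _ X]mulr1 value_const_nat.
  have := value_const_le tl; have := value_const_le (ltW tu); 
  rewrite !nat1 value_const_nat -natr1 => hu hl.
  have l1 := ler_wpM2r lam_ge0 tl; have l2 := ler_wpM2r lam_ge0 (ltW tu).
  by move: l2; rewrite ler_norml -natr1; lra.
apply/eqP; rewrite -subr_eq0 -normr_le0 leNgt; apply/negP => D0.
have [k] := exists_nat_gt (lam / `|h 0%N c - lam * c|).
rewrite ltr_pdivrMr // ltNge => /negP; apply.
by have := key k; rewrite normrM ger0_norm.
Qed.

Lemma value_scale_lt1 m s al : 0 < al < 1 -> h m (al * s) = al * h m s.
Proof.
move=> al01; have [lam0|lamN0] := eqVneq lam 0.
  (* Constants now have value zero, and a Bernoulli lottery lies between two constants. *)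
  have h0 t : h m t = 0.
    have bl : dom (bern 0 `|t|) (bern m t).
      apply: dom_trans (same_dom (bern0 _)) (dom_const_ub (lottery_bern m t) _).
      by move=> x; rewrite !inE => /orP[] /eqP-> /=; rewrite ?ler_norm.
    have bu : dom (bern m t) (bern 0 (- `|t|)).
      apply: dom_trans (dom_const_lb (lottery_bern m t) _) (same_dom (same_sym (bern0 _))).
      move=> x; rewrite !inE => /orP[] /eqP-> /=; last by rewrite oppr_le0.
      by rewrite lerNl -normrN ler_norm.
    apply/eqP; rewrite eq_le; have := value_le bl; have := value_le bu.
    by rewrite !value_const_linear lam0 !mul0r => -> ->.
  by rewrite !h0 mulr0.
(* The certainty equivalent: against it the player is indifferent, as the scaling property
   demands. *)
pose c := h m s / lam.
have [d hd hscl] := log_odds_bern i m s c.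
have d0 : d = 0.
  have := log_odds_trans hd (value_const c) (hP m s).
  by rewrite value_const_linear /c mulrCA divff // mulr1; lra.
have := log_odds_trans (hscl d0 al al01) (value_const _) (hP m (al * s)).
by move=> ->; rewrite value_const_linear add0r /c mulrCA [lam * _]mulrCA divff // mulr1.
Qed.

Lemma value_scale m s al : 0 < al -> h m (al * s) = al * h m s.
Proof.
move=> al0; have [al1|al1|->] := ltgtP al 1; last by rewrite !mul1r.
  by apply: value_scale_lt1; rewrite al0.
have h1 : 0 < al^-1 < 1 by rewrite invr_gt0 al0 invf_lt1.
have alN0 : al != 0 by rewrite gt_eqF.
by have := value_scale_lt1 m (al * s) h1; rewrite mulKf // => ->; rewrite mulVKf.
Qed.

Lemma value_bern1_ge0 m : 0 <= h m 1.
Proof.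
apply: (log_odds_dom (hP m 1)); apply: dom_const_lb; first exact: lottery_bern.
by move=> x; rewrite !inE => /orP[] /eqP-> /=.
Qed.

Lemma value_bernN1_le0 m : h m (- 1) <= 0.
Proof.
rewrite -oppr_ge0; apply: (log_odds_dom (log_odds_sym (hP m (- 1)))).
apply: dom_const_ub; first exact: lottery_bern.
by move=> x; rewrite !inE => /orP[] /eqP-> //=; rewrite oppr_le0.
Qed.

(** Prices of an arbitrarily unlikely unit loss ([l1]) and unit gain ([l3]); they become the weights
    of the minimum and the maximum. *)
Let l1 := inf (range (fun m => - h m (- 1))).
Let l3 := inf (range (fun m => h m 1)).

Lemma l1P : [/\ 0 <= l1, forall m, l1 <= - h m (- 1) &
  forall eta, 0 < eta -> exists m, - h m (- 1) < l1 + eta].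
Proof.
have lb : has_lbound (range (fun m => - h m (- 1))).
  by exists 0 => _ [m _ <-]; rewrite oppr_ge0 value_bernN1_le0.
have ne : range (fun m => - h m (- 1)) !=set0 by exists (- h 0%N (- 1)), 0%N.
split; first by apply: lb_le_inf => // _ [m _ <-]; rewrite oppr_ge0 value_bernN1_le0.
  by move=> m; apply: ge_inf => //; exists m.
move=> eta eta0; have [_ [m _ <-] hm] := @inf_adherent _ _ eta eta0 (conj ne lb).
by exists m.
Qed.

Lemma l3P : [/\ 0 <= l3, forall m, l3 <= h m 1 &
  forall eta, 0 < eta -> exists m, h m 1 < l3 + eta].
Proof.
have lb : has_lbound (range (fun m => h m 1)).
  by exists 0 => _ [m _ <-]; rewrite value_bern1_ge0.
have ne : range (fun m => h m 1) !=set0 by exists (h 0%N 1), 0%N.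
split; first by apply: lb_le_inf => // _ [m _ <-]; rewrite value_bern1_ge0.
  by move=> m; apply: ge_inf => //; exists m.
move=> eta eta0; have [_ [m _ <-] hm] := @inf_adherent _ _ eta eta0 (conj ne lb).
by exists m.
Qed.

(* A fair coin paying 0 or 1 is also 1 plus a fair coin paying 0 or -1. *)
Lemma l2_ge0 : 0 <= lam - l1 - l3.
Proof.
have [_ /(_ 1%N) h1 _] := l1P; have [_ /(_ 1%N) h3 _] := l3P.
suff : h 1%N 1 = lam + h 1%N (- 1) by move: h1 h3; lra.
apply: log_odds_inj (hP 1%N 1) (log_odds_conv0 (value_const 1) (hP 1%N (- 1))) _.
move=> f; rewrite expect_conv expect_const !expect_bern addr0 subrr addrC.
by have -> : 1 - 2^-1 = 2^-1 :> R by lra.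
Qed.

Lemma value_bracket k m m' c s s' : log_odds i (bracket k m m' c s s') (const 0)
  (k%:R * (lam * c) + h m (k%:R * s) + h m' (k%:R * s')).
Proof.
rewrite mulrCA -value_const_linear; apply: log_odds_conv0 => //; apply: log_odds_conv0 => //.
exact: value_const.
Qed.

(** The weights add up to [lam] because minimum, mean and maximum of a constant coincide. *)
Definition mmm_value (X : seq (R * R)) (x0 x1 : R) : R :=
  l1 * x0 + (lam - l1 - l3) * mean X + l3 * x1.

(** One coefficient of [eta] that serves both approximations; its last term absorbs [eta ^+ 2]. *)
Definition slack (x0 x1 : R) : R := lam + (x1 - x0) + l1 + l3 + 1.

(** The index [m] is fixed first, with [h m 1] close to [l3]. The index [m'] depends on [k] and is
    not controlled, but [h m' (- 1) <= - l1] holds for all of them, in the right direction. *)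
Lemma upper_value X x0 x1 eta : spans X x0 x1 -> 0 < eta <= 1 ->
  exists k0 : nat, forall k, (k0 < k)%N -> exists W w,
    [/\ log_odds i W (const 0) w, dom W (copies X k) &
        w <= k%:R * (mmm_value X x0 x1 + eta * slack x0 x1)].
Proof.
move=> sX /andP[eta0 eta1]; have [l10 l1le _] := l1P; have [l30 _ l3near] := l3P.
have [m hm] := l3near _ eta0; have [k0 hk0] := upper_bracket m sX eta0.
have /andP[ml mu] := spans_mean sX.
exists k0 => k k0k; have [m' domk] := hk0 k k0k.
have vk := value_bracket k m m' (mean X + eta) (x1 - mean X + eta) (- (mean X + eta - x0)).
eexists; eexists; split; [exact: vk|exact: domk|].
have k_gt0 : 0 < k%:R :> R by rewrite ltr0n (leq_trans _ k0k).
rewrite -[x1 - mean X + eta]mulr1 -[mean X + eta - x0]mulr1 -[- (_ * 1)]mulrN.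
rewrite !mulrA !value_scale; [|by rewrite mulr_gt0 //; lra..].
rewrite -!mulrA -!mulrDr ler_pM2l //.
have H1 : 0 <= (x1 - mean X + eta) * (l3 + eta - h m 1).
  by apply: mulr_ge0; move: hm; lra.
have H2 : 0 <= (mean X + eta - x0) * (- l1 - h m' (- 1)).
  by apply: mulr_ge0; have := l1le m'; lra.
have H3 : 0 <= eta * (mean X - x0) by rewrite mulr_ge0 ?(ltW eta0) // subr_ge0.
have H4 := mulr_ge0 (ltW eta0) l10.
have H5 : 0 <= eta * (1 - eta) by rewrite mulr_ge0 ?(ltW eta0) // subr_ge0.
rewrite -subr_ge0 /mmm_value /slack.
have := addr_ge0 (addr_ge0 (addr_ge0 (addr_ge0 H1 H2) H3) (addr_ge0 H4 H4)) H5.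
congr (0 <= _); ring.
Qed.

(** Here [m] prices the downward jump close to [l1], and the uncontrolled [m'] uses
    [l3 <= h m' 1]. *)
Lemma lower_value X x0 x1 eta : spans X x0 x1 -> 0 < eta <= 1 ->
  exists k0 : nat, forall k, (k0 < k)%N -> exists V v,
    [/\ log_odds i V (const 0) v, dom (copies X k) V &
        k%:R * (mmm_value X x0 x1 - eta * slack x0 x1) <= v].
Proof.
move=> sX /andP[eta0 eta1]; have [l10 _ l1near] := l1P; have [l30 l3le _] := l3P.
have [m hm] := l1near _ eta0; have [k0 hk0] := lower_bracket m sX eta0.
have /andP[ml mu] := spans_mean sX.
exists k0 => k k0k; have [m' domk] := hk0 k k0k.
have vk := value_bracket k m m' (mean X - eta) (- (mean X - x0 + eta)) (x1 - mean X + eta).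
eexists; eexists; split; [exact: vk|exact: domk|].
have k_gt0 : 0 < k%:R :> R by rewrite ltr0n (leq_trans _ k0k).
rewrite -[x1 - mean X + eta]mulr1 -[mean X - x0 + eta]mulr1 -[- (_ * 1)]mulrN.
rewrite !mulrA !value_scale; [|by rewrite mulr_gt0 //; lra..].
rewrite -!mulrA -!mulrDr ler_pM2l //.
have H1 : 0 <= (mean X - x0 + eta) * (l1 + eta + h m (- 1)).
  by apply: mulr_ge0; move: hm; lra.
have H2 : 0 <= (x1 - mean X + eta) * (h m' 1 - l3).
  by apply: mulr_ge0; have := l3le m'; lra.
have H3 : 0 <= eta * (x1 - mean X) by rewrite mulr_ge0 ?(ltW eta0) // subr_ge0.
have H4 := mulr_ge0 (ltW eta0) l30.
have H5 : 0 <= eta * (1 - eta) by rewrite mulr_ge0 ?(ltW eta0) // subr_ge0.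
rewrite -subr_ge0 /mmm_value /slack.
have := addr_ge0 (addr_ge0 (addr_ge0 (addr_ge0 H1 H2) H3) (addr_ge0 H4 H4)) H5.
congr (0 <= _); ring.
Qed.

Lemma slack_gt0 X x0 x1 : spans X x0 x1 -> 0 < slack x0 x1.
Proof.
move=> /spans_mean/andP[a b]; have := lam_ge0.
by rewrite /slack; have [a1 _ _] := l1P; have [a3 _ _] := l3P; lra.
Qed.

(** Bounding [k] copies of [X] from above and of [Y] from below bounds [k%:R * d]; [k] then cancels,
    and [eta] is chosen to keep the total slack below [eps]. *)
Lemma log_odds_le_mmm X Y x0 x1 y0 y1 d : log_odds i X Y d ->
  spans X x0 x1 -> spans Y y0 y1 -> d <= mmm_value X x0 x1 - mmm_value Y y0 y1.
Proof.
move=> hd sX sY; apply/ler_addgt0Pr => eps eps0.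
set K := slack x0 x1 + slack y0 y1.
have K0 : 0 < K by rewrite addr_gt0 ?(slack_gt0 sX) ?(slack_gt0 sY).
pose eta := Num.min 1 (eps / K).
have eta01 : 0 < eta <= 1 by rewrite lt_min ltr01 divr_gt0 //= ge_min lexx.
have etaK : eta * K <= eps by rewrite -ler_pdivlMr // ge_min lexx orbT.
have [k1 H1] := upper_value sX eta01; have [k2 H2] := lower_value sY eta01.
pose k := (maxn k1 k2).+1.
have [|W [w [hW dW wle]]] := H1 k; first by rewrite ltnS leq_maxl.
have [|V [v [hV dV vge]]] := H2 k; first by rewrite ltnS leq_maxr.
have [[lW _ _] [lV _ _]] := (hW, hV).
have hWV : log_odds i W V (w - v).
  have := log_odds_conv hW (log_odds_sym hV); apply: log_odds_same => //.
    exact: conv0.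
  by move=> f; rewrite convC conv0.
have kd := log_odds_le hWV (log_odds_copies k hd) dW dV.
have k_gt0 : 0 < k%:R :> R by rewrite ltr0n.
rewrite -(ler_pM2l k_gt0); apply: (le_trans kd).
by move: (ler_wpM2l (ltW k_gt0) etaK) wle vge; rewrite /K; lra.
Qed.

Lemma log_odds_mmm X Y x0 x1 y0 y1 d : log_odds i X Y d ->
  spans X x0 x1 -> spans Y y0 y1 -> d = mmm_value X x0 x1 - mmm_value Y y0 y1.
Proof.
move=> hd sX sY; apply/eqP; rewrite eq_le (log_odds_le_mmm hd) //=.
by rewrite -lerN2 opprB (log_odds_le_mmm (log_odds_sym hd)).
Qed.

(** Log-odds of any player [l] are moved to the fixed player [i], so the weights are common to all;
    exponentiating and normalising yields the logit form. *)
Lemma refines_mmm :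
  refines S (@min_max_mean R U n l1 (lam - l1 - l3) l3).
Proof.
move=> G p Gp l a; have mp := S_mixed Gp; have [j jl] := other_player l.
set I := mmm_index l1 (lam - l1 - l3) l3 p.
have odds b : ln (p l b) - ln (p l a) = I l b - I l a.
  have sp c := spans_law (p := p) c mp jl (fun l' x => hin x Gp).
  have := log_odds_mmm (log_odds_player i (log_odds_law b a Gp)) (sp b) (sp a).
  by rewrite /mmm_value -!mean_payoffE.
have pb b : p l b = p l a / expR (I l a) * expR (I l b).
  rewrite -[LHS]lnK ?posrE ?hin // -[p l a]lnK ?posrE ?hin // -expRN -!expRD.
  by congr expR; have := odds b; lra.
have := (mp l).2; under eq_bigr do rewrite pb.
rewrite -mulr_sumr; set T := \sum_b _ => pT.
have T0 : T != 0
  by apply/eqP => T0; move: pT; rewrite T0 mulr0 => /eqP; rewrite eq_sym oner_eq0.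
rewrite -/I -[LHS](divfK (lt0r_neq0 (expR_gt0 (I l a)))) mulrC.
by congr (_ * _); rewrite -[T^-1]mul1r -pT mulfK.
Qed.

End Values.
End LogOdds.

(** * Choice of the weights *)

Lemma infinite_set_injection (U : choiceType) :
  infinite_set [set: U] -> exists e : nat -> U, injective e.
Proof.
move=> /infiniteP/card_leP[f]; exists (fun k => val (f (SigSub (mem_setT k)))).
by move=> x y /val_inj /(inj (f := f)) - /(_ (mem_setT _) (mem_setT _)) [].
Qed.

Theorem theorem3 (R : realType) (n : nat) (hn : (2 <= n)%N)
    (U : choiceType) (pr : U * U -> U)
    (hU : infinite_set [set: U]) (hpr : injective pr)
    (S : correspondence R U n)
    (hS : solution_concept S)
    (hbr : permits_bracketing pr S)
    (hdm : distribution_monotone S)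
    (han : anonymous S)
    (hsc : scale_invariant S)
    (hin : interior_valued S) :
  exists l1 l2 l3 : R,
    [/\ 0 <= l1, 0 <= l2, 0 <= l3 & refines S (@min_max_mean R U n l1 l2 l3)].
Proof.
have [e e_inj] := infinite_set_injection hU.
(* [hn] unfolds to [1 < n], so this is the player of index 1. *)
pose i := Ordinal hn.
have hP (ms : nat * R) : exists d, @log_odds R n U S i (bern ms.1 ms.2) (const 0) d.
  have [d hd _] := log_odds_bern hn hpr hS hbr hdm hsc hin e_inj i ms.1 ms.2 0.
  by exists d.
(* Existence of log-odds for each pair [(m, s)] becomes a value function. *)
have [v vP] := choice hP.
pose h m s := v (m, s).
have {}vP m s : @log_odds R n U S i (bern m s) (const 0) (h m s) by exact: (vP (m, s)).
pose l1 := inf (range (fun m => - h m (- 1))).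
pose l3 := inf (range (fun m => h m 1)).
exists l1, (h 0%N 1 - l1 - l3), l3; split.
- by have [] := l1P hn hpr hS hbr hdm hin e_inj vP.
- exact: (l2_ge0 hn hpr hS hbr hdm hin e_inj vP).
- by have [] := l3P hn hpr hS hbr hdm hin e_inj vP.
- exact: (refines_mmm hn hpr hS hbr hdm han hsc hin e_inj vP).
Qed.
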